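(* Let $R>1$. Then there exists a constant $C=C(R)>0$ such that for all constants $L>1$ there exists a symplectic embedding $\Phi:B(\pi R^2)\hookrightarrow\mathbb{R}^4$ with Lipschitz constant at most $L$ such that $$\mathrm{Vol}_4\big(E(\Phi)\big)\ \le\ \frac{C}{L}.$$
   Context: $\mathbb{R}^4$ has coordinates $(x_1,y_1,x_2,y_2)$, the Euclidean metric, and the standard symplectic form $\omega = dx_1\wedge dy_1+dx_2\wedge dy_2$. A symplectic embedding is a smooth embedding $\Phi$ with $\Phi^*\omega=\omega$. $B(\pi R^2)\subset\mathbb{R}^4$ is the open ball of radius $R$ centered at the origin, and $Z(\pi)=\{x_1^2+y_1^2<1\}$ is the open cylinder of radius $1$. For a symplectic embedding $\Phi:B(\pi R^2)\hookrightarrow\mathbb{R}^4$, set $E(\Phi):=B(\pi R^2)\setminus\Phi^{-1}(Z(\pi))=\Phi^{-1}(\mathbb{R}^4\setminus Z(\pi))$. $\mathrm{Vol}_4$ is Euclidean $4$-volume. *)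

(* Defs.v *)
From mathcomp Require Import all_boot all_order all_algebra.
From mathcomp Require Import all_classical all_reals all_analysis.
Set Implicit Arguments.
Unset Strict Implicit.
Unset Printing Implicit Defensive.
Import Order.TTheory GRing.Theory Num.Theory.
Import numFieldNormedType.Exports.
Local Open Scope classical_set_scope.
Local Open Scope ring_scope.

(* The library norm on this product is the sup norm.  It is used below only
   through its topology and its notion of differentiability, which are also the
   Euclidean ones; the metric notions (balls, Lipschitz constants) are stated
   with [enorm]. *)
Notation R4 R := (R * R * R * R)%type.

Section Euclidean.
Context {R : realType}.
Implicit Types (p q : R4 R) (r L : R) (U : set (R4 R)).

(* The coordinates of the point (x1, y1, x2, y2), i.e. (((x1, y1), x2), y2). *)
Definition x1 p : R := p.1.1.1.
Definition y1 p : R := p.1.1.2.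
Definition x2 p : R := p.1.2.
Definition y2 p : R := p.2.

Definition enorm p : R :=
  Num.sqrt (x1 p ^+ 2 + y1 p ^+ 2 + x2 p ^+ 2 + y2 p ^+ 2).

Definition lipschitz_at_most L U (f : R4 R -> R4 R) : Prop :=
  forall p q, U p -> U q -> enorm (f p - f q) <= L * enorm (p - q).

Definition Vol4 : set (R4 R) -> \bar R :=
  (@lebesgue_measure R \x @lebesgue_measure R
     \x @lebesgue_measure R \x @lebesgue_measure R)%E.

(* B(pi * r ^+ 2): the argument is the radius, not the capacity. *)
Definition open_ball r : set (R4 R) := [set p | enorm p < r].

Definition cylinder : set (R4 R) := [set p | x1 p ^+ 2 + y1 p ^+ 2 < 1].

End Euclidean.

Section Smooth.
Context {R : realType} {V W : normedModType R}.
Implicit Types (U : set V) (f : V -> W).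

(* C^k on an open subset U of a finite-dimensional space: f is C^(k+1) when it
   is differentiable on U and each directional derivative x |-> 'd f x v is
   C^k on U.  Values of f outside U play no role. *)
Fixpoint Ck k U f : Prop :=
  if k is k'.+1 then
    (forall x, U x -> differentiable f x) /\
    (forall v, Ck k' U (fun x => 'd f x v))
  else forall x, U x -> {for x, continuous f}.

Definition smooth U f : Prop := forall k, Ck k U f.

Definition immersion U f : Prop := forall x, U x -> injective ('d f x).

(* f restricted to U is a homeomorphism onto its image, g being the inverse. *)
Definition topological_embedding U f : Prop :=
  {within U, continuous f} /\
  exists g : W -> V,
    {within f @` U, continuous g} /\ (forall x, U x -> g (f x) = x).

Definition smooth_embedding U f : Prop :=
  [/\ smooth U f, immersion U f & topological_embedding U f].

End Smooth.

Section Symplectic.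
Context {R : realType}.
Implicit Types (u v p : R4 R) (r : R) (U : set (R4 R)) (Phi : R4 R -> R4 R).

Definition omega u v : R :=
  (x1 u * y1 v - y1 u * x1 v) + (x2 u * y2 v - y2 u * x2 v).

Definition symplectic_embedding U Phi : Prop :=
  smooth_embedding U Phi /\
  forall p, U p -> forall u v, omega ('d Phi p u) ('d Phi p v) = omega u v.

(* E(Phi), for an embedding Phi of the open ball of radius r. *)
Definition outside_cylinder r Phi : set (R4 R) :=
  open_ball r `\` Phi @^-1` cylinder.

End Symplectic.

(* Main.v *)
Require Import Defs.
From HB Require Import structures.
From mathcomp Require Import all_boot all_order all_algebra.
From mathcomp Require Import all_classical all_reals all_analysis.
From mathcomp Require Import measurable_realfun ring lra.
Set Implicit Arguments.
Unset Strict Implicit.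
Unset Printing Implicit Defensive.
Import Order.TTheory GRing.Theory Num.Theory.
Import numFieldNormedType.Exports.
Local Open Scope classical_set_scope.
Local Open Scope ring_scope.

(** Why squeezing with loss of order 1/L is possible.  The embedding is the
    composition [squeeze] of three explicit symplectomorphisms of R^4, each
    built from a function of one variable.  A number c of order 1/L measures
    the width of the necks along which the ball is torn.

    - [squeeze_stretch] is an area-preserving map of the (x1, y1)-plane,
      (x, y) |-> (phi x, y / phi' x).  It divides the x1-axis into strips of
      length pi / (200 r), separated by necks of width of order c.  Each
      strip is compressed to a small interval around a multiple of 2 pi r,
      and each neck is stretched to a length of about 2 pi r while becoming
      thin in the y1-direction.  A strip of the disc of radius r has area of
      order 1, and its image is a rectangle that fits in the unit disc.
    - [squeeze_lift] is the shear x2 += F x1, y1 -= F' x1 * y2, where F is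
      nearly constant on the images of the strips and climbs along the necks.
      The necks being long now, bounds on the derivatives of F can be chosen
      independently of c.  The k-th strip is lifted by 200 pi r^2 k, so that
      distinct strips have disjoint ranges of x2.
    - [squeeze_fold] is a shear of the same kind with the two planes
      exchanged: x1 is translated by an amount that depends on x2, which
      brings all strips above the same small rectangle inside the unit disc.
      The compensating change affects y2 only, on which the cylinder sets
      no condition.

    What leaves the cylinder therefore comes from the necks, which form a set
    of volume of order c in the ball ([squeeze_outside_cylinder],
    [Vol4_le_slabs]).

    The Lipschitz constant is of order 1/c, and not worse, because of the shape
    of the necks.  The derivative of y / phi' x in x contains the derivative of
    1 / phi', and this only has to drop from order 1 to order c within a length
    of order c.  The function [neck] achieves this: it is a convex combination
    of the identity and of the lift of the Moebius transformation of the circle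
    which multiplies tan (s / 2) by c.  The derivative of this lift is a Poisson
    kernel, whose inverse is an affine function of cos s.

    Taking c = K / L, with K depending on r only, gives the theorem for L > K.
    For L <= K the identity serves, since the volume of the ball is then at most
    a constant times 1 / L.

    All maps are compositions of sums, products, inverses, sin, cos and atan.
    The class [elementary] of such functions is closed under directional
    derivatives, which yields smoothness to all orders at once, and its members
    are measurable. *)

(** * Differentials of elementary functions *)

Section linear_fst.
Context {R : realType} {V W : normedModType R}.

Lemma is_diff_fst (p : V * W) : is_diff p fst fst.
Proof.
have lin : linear (fst : V * W -> V) by [].
pose L : {linear (V * W)%type -> V} :=
  HB.pack (fst : V * W -> V) (GRing.isLinear.Build _ _ _ _ _ lin).
have cL : continuous (L : V * W -> V) by move=> x; apply: cvg_fst.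
have dL : differentiable (L : V * W -> V) p by exact: linear_differentiable.
by apply: DiffDef => //; exact: (diff_lin _ cL).
Qed.

Lemma is_diff_snd (p : V * W) : is_diff p snd snd.
Proof.
have lin : linear (snd : V * W -> W) by [].
pose L : {linear (V * W)%type -> W} :=
  HB.pack (snd : V * W -> W) (GRing.isLinear.Build _ _ _ _ _ lin).
have cL : continuous (L : V * W -> W) by move=> x; apply: cvg_snd.
have dL : differentiable (L : V * W -> W) p by exact: linear_differentiable.
by apply: DiffDef => //; exact: (diff_lin _ cL).
Qed.

End linear_fst.

Section coordinates.
Context {R : realType}.
Implicit Types p : R4 R.

Lemma is_diff_x1 p : is_diff p x1 x1.
Proof.
exact: (is_diff_comp (is_diff_comp (is_diff_fst p) (is_diff_fst _)) (is_diff_fst _)).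
Qed.

Lemma is_diff_y1 p : is_diff p y1 y1.
Proof.
exact: (is_diff_comp (is_diff_comp (is_diff_fst p) (is_diff_fst _)) (is_diff_snd _)).
Qed.

Lemma is_diff_x2 p : is_diff p x2 x2.
Proof. exact: (is_diff_comp (is_diff_fst p) (is_diff_snd _)). Qed.

Lemma is_diff_y2 p : is_diff p y2 y2.
Proof. exact: is_diff_snd. Qed.
End coordinates.

Lemma is_diff_comp1 {R : realType} {V : normedModType R} (phi : R -> R) (d : R)
    (f df : V -> R) (p : V) :
  is_derive (f p) 1 phi d -> is_diff p f df ->
  is_diff p (fun q => phi (f q)) (fun u => d * df u).
Proof.
move=> dphi dfp.
have dphi' : differentiable phi (f p) by apply/derivable1_diffP; exact: ex_derive.
have Dphi : is_diff (f p) phi (fun h => h * d).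
  apply: DiffDef => //; rewrite diff1E // derive1E; apply/funext => h.
  by rewrite derive_val.
have H := is_diff_comp dfp Dphi.
by apply: (is_diff_eq H); apply/funext => u /=; rewrite mulrC.
Qed.

(** A class of functions stable under directional derivatives and under
    composition: this replaces a calculus of C^k functions. *)
Inductive elementary {R : realType} : (R4 R -> R) -> Prop :=
| elementary_cst c : elementary (fun=> c)
| elementary_x1 : elementary x1
| elementary_y1 : elementary y1
| elementary_x2 : elementary x2
| elementary_y2 : elementary y2
| elementaryD f g :
    elementary f -> elementary g -> elementary (fun p => f p + g p)
| elementaryM f g :
    elementary f -> elementary g -> elementary (fun p => f p * g p)
| elementaryV f : (forall p, f p != 0) ->
    elementary f -> elementary (fun p => (f p)^-1)
| elementary_sin f : elementary f -> elementary (fun p => sin (f p))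
| elementary_cos f : elementary f -> elementary (fun p => cos (f p))
| elementary_atan f : elementary f -> elementary (fun p => atan (f p)).

Section elementary.
Context {R : realType}.
Implicit Types f g : R4 R -> R.

Lemma elementaryN f : elementary f -> elementary (fun p => - f p).
Proof.
move=> ef; rewrite (_ : (fun p => - f p) = fun p => (-1) * f p).
  exact: elementaryM (elementary_cst _) ef.
by apply/funext => p; rewrite mulN1r.
Qed.

Lemma elementaryB f g :
  elementary f -> elementary g -> elementary (fun p => f p - g p).
Proof. by move=> ef eg; exact: elementaryD ef (elementaryN eg). Qed.

Lemma is_deriveV1 (x : R) : x != 0 -> is_derive x 1 (@GRing.inv R) (- x ^- 2).
Proof.
move=> x0; have /= := is_deriveV x0 (is_derive_id x (1 : R)).
by rewrite [_ *: _]mulr1.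
Qed.

(** The stability under derivatives is proved by induction, each constructor
    having a differential that the constructors express. *)
Lemma elementary_diff f : elementary f ->
  exists df : R4 R -> R4 R -> R,
    (forall p, is_diff p f (df p)) /\ forall u, elementary (df ^~ u).
Proof.
elim=> [c||||
       |g h _ [dg [gd ge]] _ [dh [hd he]]
       |g h eg [dg [gd ge]] eh [dh [hd he]]
       |g g0 eg [dg [gd ge]]|g eg [dg [gd ge]]|g eg [dg [gd ge]]|g eg [dg [gd ge]]].
- exists (fun=> 0); split => [p|u]; last exact: elementary_cst.
  exact: is_diff_cst.
- exists (fun=> x1); split => [p|u]; [exact: is_diff_x1|exact: elementary_cst].
- exists (fun=> y1); split => [p|u]; [exact: is_diff_y1|exact: elementary_cst].
- exists (fun=> x2); split => [p|u]; [exact: is_diff_x2|exact: elementary_cst].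
- exists (fun=> y2); split => [p|u]; [exact: is_diff_y2|exact: elementary_cst].
- exists (fun p u => dg p u + dh p u); split => [p|u]; last exact: elementaryD.
  exact: is_diffD.
- exists (fun p u => g p * dh p u + h p * dg p u); split => [p|u].
    exact: is_diffM.
  by apply: elementaryD; exact: elementaryM.
- exists (fun p u => - ((g p)^-1 * (g p)^-1) * dg p u); split => [p|u].
    rewrite -invfM -expr2; apply: is_diff_comp1 (gd p).
    exact: is_deriveV1.
  by apply: elementaryM => //; apply: elementaryN; apply: elementaryM; exact: elementaryV.
- exists (fun p u => cos (g p) * dg p u); split => [p|u].
    exact: is_diff_comp1 (gd p).
  by apply: elementaryM => //; exact: elementary_cos.
- exists (fun p u => - sin (g p) * dg p u); split => [p|u].
    exact: is_diff_comp1 (gd p).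
  by apply: elementaryM => //; apply: elementaryN; exact: elementary_sin.
- exists (fun p u => (1 + g p * g p)^-1 * dg p u); split => [p|u].
    by rewrite -expr2; apply: is_diff_comp1 (gd p).
  apply: elementaryM => //; apply: elementaryV => [p|].
    by rewrite gt_eqF// ltr_pwDl// -expr2 sqr_ge0.
  by apply: elementaryD; [exact: elementary_cst|exact: elementaryM].
Qed.

End elementary.

(** * Elementary maps and symplectomorphisms of R^4 *)

Section elementary_maps.
Context {R : realType}.
Implicit Types F G : R4 R -> R4 R.

Definition elementary_map F :=
  [/\ elementary (fun p => x1 (F p)), elementary (fun p => y1 (F p)),
      elementary (fun p => x2 (F p)) & elementary (fun p => y2 (F p))].

Lemma elementary_comp (f : R4 R -> R) F :
  elementary f -> elementary_map F -> elementary (fun p => f (F p)).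
Proof.
move=> ef [F1 F2 F3 F4]; elim: ef => //=
  [c|g h _ ? _ ?|g h _ ? _ ?|g g0 _ ?|g _ ?|g _ ?|g _ ?].
- exact: elementary_cst.
- exact: elementaryD.
- exact: elementaryM.
- exact: elementaryV.
- exact: elementary_sin.
- exact: elementary_cos.
- exact: elementary_atan.
Qed.

Lemma elementary_map_comp F G :
  elementary_map G -> elementary_map F -> elementary_map (fun p => G (F p)).
Proof.
by move=> [G1 G2 G3 G4] eF; split;
  [exact: elementary_comp G1 eF|exact: elementary_comp G2 eF
  |exact: elementary_comp G3 eF|exact: elementary_comp G4 eF].
Qed.

Lemma is_diff_coords F (dF : R4 R -> R4 R) (p : R4 R) :
  is_diff p (fun q => x1 (F q)) (fun u => x1 (dF u)) ->
  is_diff p (fun q => y1 (F q)) (fun u => y1 (dF u)) ->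
  is_diff p (fun q => x2 (F q)) (fun u => x2 (dF u)) ->
  is_diff p (fun q => y2 (F q)) (fun u => y2 (dF u)) ->
  is_diff p F dF.
Proof.
move=> d1 d2 d3 d4.
have eta (H : R4 R -> R4 R) :
    H = fun q => (x1 (H q), y1 (H q), x2 (H q), y2 (H q)).
  by apply/funext => q; rewrite /x1 /y1 /x2 /y2; case: (H q) => [[[]]].
rewrite (eta F) (eta dF).
exact: (is_diff_pair (is_diff_pair (is_diff_pair d1 d2) d3) d4).
Qed.

Lemma elementary_map_diff F : elementary_map F ->
  exists dF : R4 R -> R4 R -> R4 R,
    (forall p, is_diff p F (dF p)) /\ forall u, elementary_map (dF ^~ u).
Proof.
move=> [/elementary_diff [d1 [D1 E1]] /elementary_diff [d2 [D2 E2]]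
        /elementary_diff [d3 [D3 E3]] /elementary_diff [d4 [D4 E4]]].
exists (fun p u => (d1 p u, d2 p u, d3 p u, d4 p u)).
split=> [p|u]; last by split; [exact: E1|exact: E2|exact: E3|exact: E4].
have H := @is_diff_coords F (fun u => (d1 p u, d2 p u, d3 p u, d4 p u)) p.
by apply: H.
Qed.

Lemma elementary_map_differentiable F p : elementary_map F -> differentiable F p.
Proof. by move=> /elementary_map_diff[dF [D _]]; have Dp := D p; exact: ex_diff. Qed.

Lemma elementary_map_continuous F : elementary_map F -> continuous F.
Proof.
move=> eF p; apply: differentiable_continuous.
exact: elementary_map_differentiable.
Qed.

(** Directional derivatives of elementary maps are elementary maps, so the
    induction on k needs no estimate at all. *)
Lemma elementary_map_smooth U F : elementary_map F -> smooth U F.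
Proof.
move=> eF k; elim: k F eF => [|k IHk] F eF /=.
  by move=> p _; exact: elementary_map_continuous.
split => [p _|u]; first exact: elementary_map_differentiable.
have [dF [D E]] := elementary_map_diff eF.
rewrite (_ : (fun p => 'd F p u) = dF ^~ u); first exact: IHk.
by apply/funext => p; have := D p; move=> Dp; rewrite diff_val.
Qed.

Lemma omega_nondegenerate (u : R4 R) : (forall v, omega u v = 0) -> u = 0.
Proof.
case: u => [[[a b] c] d] h.
have := h (1, 0, 0, 0); have := h (0, 1, 0, 0).
have := h (0, 0, 1, 0); have := h (0, 0, 0, 1).
rewrite /omega /x1 /y1 /x2 /y2 /= => h4 h3 h2 h1.
by congr (_, _, _, _); lra.
Qed.

Definition preserves_omega F :=
  forall p u v, omega ('d F p u) ('d F p v) = omega u v.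

(** A continuous left inverse defined everywhere restricts to a continuous
    inverse on the image of any subset, whence topological embeddings. *)
Definition elementary_symplectomorphism F :=
  [/\ elementary_map F, preserves_omega F
    & exists2 G, continuous G & cancel F G].

Lemma elementary_symplectomorphism_comp F G :
  elementary_symplectomorphism G -> elementary_symplectomorphism F ->
  elementary_symplectomorphism (fun p => G (F p)).
Proof.
move=> [eG wG [Gi cGi GK]] [eF wF [Fi cFi FK]]; split.
- exact: elementary_map_comp.
- move=> p u v.
  rewrite (@diff_comp _ _ _ _ F G p) ?wG ?wF//; exact: elementary_map_differentiable.
- exists (Fi \o Gi); last by move=> p /=; rewrite GK FK.
  by move=> p; apply: continuous_comp; [exact: cGi|exact: cFi].
Qed.

(** A linear map that preserves a nondegenerate form is injective. *)
Lemma omega_immersion U F : elementary_map F -> preserves_omega F -> immersion U F.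
Proof.
move=> eF wF p _ u v uv; apply/eqP; rewrite -subr_eq0; apply/eqP.
apply: omega_nondegenerate => w; rewrite -(wF p) linearB uv subrr.
by rewrite /omega /x1 /y1 /x2 /y2 /= !mul0r !subr0 addr0.
Qed.

Lemma elementary_symplectomorphism_embedding U F :
  elementary_symplectomorphism F -> symplectic_embedding U F.
Proof.
move=> [eF wF [G cG FK]]; split; last by move=> p _; exact: wF.
split; first exact: elementary_map_smooth.
  exact: omega_immersion.
split; first exact/continuous_subspaceT/elementary_map_continuous.
by exists G; split => //; exact: continuous_subspaceT.
Qed.

End elementary_maps.

(** * Measurability and volume *)

Section volume.
Context {R : realType}.
Local Notation mR := (measurableTypeR R).
Local Notation mR4 := (mR * mR * mR * mR)%type.

(** The Lebesgue measure lives on a copy of R, with the same measurable sets but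
    another display; this identity passes from one to the other. *)
Lemma measurable_id_mR : measurable_fun setT (idfun : mR -> R).
Proof. by move=> _ Y mY; rewrite setTI. Qed.

Lemma elementary_measurable (f : R4 R -> R) :
  elementary f -> measurable_fun setT (f : mR4 -> R).
Proof.
elim=> [c|||||g h _ ? _ ?|g h _ ? _ ?|g g0 _ mg|g _ mg|g _ mg|g _ mg].
- exact: measurable_cst.
- exact: (measurableT_comp measurable_id_mR (measurableT_comp
    (f := @fst mR mR) measurable_fst (measurableT_comp measurable_fst measurable_fst))).
- exact: (measurableT_comp measurable_id_mR (measurableT_comp
    (f := @snd mR mR) measurable_snd (measurableT_comp measurable_fst measurable_fst))).
- exact: (measurableT_comp measurable_id_mR
    (measurableT_comp measurable_snd measurable_fst)).
- exact: (measurableT_comp measurable_id_mR measurable_snd).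
- exact: measurable_funD.
- exact: measurable_funM.
- apply: (measurable_comp (F := [set x : R | x != 0])) mg => //.
  + by apply: open_measurable; exact: open_neq.
  + by move=> _ [p _ <-]; exact: g0.
  + apply: open_continuous_measurable_fun; first exact: open_neq.
    by move=> x; rewrite inE /=; exact: inv_continuous.
- by apply: measurableT_comp mg; exact: continuous_measurable_fun (@continuous_sin R).
- by apply: measurableT_comp mg; exact: continuous_measurable_fun (@continuous_cos R).
- by apply: measurableT_comp mg; exact: continuous_measurable_fun (@continuous_atan R).
Qed.

Lemma measurable_elementary_lt (f : R4 R -> R) c :
  elementary f -> measurable ([set p | f p < c] : set mR4).
Proof.
move=> /elementary_measurable mf; rewrite -[X in measurable X]setTI.
have -> : [set p | f p < c] = f @^-1` `]-oo, c[%classic.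
  by apply/seteqP; split => p /=; rewrite in_itv.
by apply: mf => //; exact: measurable_itv.
Qed.

Lemma elementaryX2 (f : R4 R -> R) : elementary f -> elementary (fun p => f p ^+ 2).
Proof. by move=> ef; under eq_fun do rewrite expr2; exact: elementaryM. Qed.

Lemma open_ballE (r : R) : 0 < r -> open_ball r =
  [set p | x1 p ^+ 2 + y1 p ^+ 2 + x2 p ^+ 2 + y2 p ^+ 2 < r ^+ 2].
Proof.
move=> r0; apply/funext => p; rewrite /open_ball /enorm /=.
have -> : r = Num.sqrt (r ^+ 2) by rewrite sqrtr_sqr gtr0_norm.
by rewrite ltr_sqrt ?exprn_gt0// sqr_sqrtr ?sqr_ge0.
Qed.

Lemma measurable_outside_cylinder (r : R) F : 0 < r -> elementary_map F ->
  measurable (outside_cylinder r F : set mR4).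
Proof.
move=> r0 [F1 F2 F3 F4]; apply: measurableD.
  rewrite open_ballE//; apply: measurable_elementary_lt.
  by do !apply: elementaryD; apply: elementaryX2; constructor.
by apply: measurable_elementary_lt; apply: elementaryD; exact: elementaryX2.
Qed.

(** The part of the cube of half-side r that lies above an interval of the
    x1-axis of length l: the pieces of the ball that are lost have this shape. *)
Definition slab (r a l : R) : set (R4 R) :=
  `[a, a + l] `*` `[- r, r] `*` `[- r, r] `*` `[- r, r].

Lemma measurable_slab r a l : measurable (slab r a l : set mR4).
Proof. by do !apply: measurableX; exact: measurable_itv. Qed.

Lemma lebesgue_measure_itvcc (a b : R) : a <= b ->
  @lebesgue_measure R `[a, b]%classic = (b - a)%:E.
Proof.
move=> ab; rewrite lebesgue_measure_itv /= lte_fin.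
by case: ltgtP ab => //= -> _; rewrite subrr.
Qed.

Lemma Vol4_slab r a l : 0 <= r -> 0 <= l -> Vol4 (slab r a l) = (l * (2 * r) ^+ 3)%:E.
Proof.
move=> r0 l0; rewrite /Vol4 /slab.
have m a' b' : measurable (`[a', b']%classic : set mR) by exact: measurable_itv.
have rr : - r <= r by lra.
have E1 := product_measure1E (@lebesgue_measure R) (@lebesgue_measure R)
  (m a (a + l)) (m (- r) r).
have E2 := product_measure1E (@lebesgue_measure R \x @lebesgue_measure R)%E
  (@lebesgue_measure R) (measurableX (m a (a + l)) (m (- r) r)) (m (- r) r).
rewrite product_measure1E//; last by do !apply: measurableX.
rewrite /= in E1 E2 *; rewrite E2 E1 !lebesgue_measure_itvcc ?lerDl//.
by rewrite -!EFinM; congr EFin; ring.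
Qed.

Lemma Vol4_le_slabs (E : set (R4 R)) n r l (a : nat -> R) :
  0 <= r -> 0 <= l -> measurable (E : set mR4) ->
  E `<=` \bigcup_(i < n) slab r (a i) l ->
  (Vol4 E <= (n%:R * l * (2 * r) ^+ 3)%:E)%E.
Proof.
move=> r0 l0 mE EU.
have h := @content_subadditive _ _ _ (@lebesgue_measure R \x @lebesgue_measure R
     \x @lebesgue_measure R \x @lebesgue_measure R)%E E (fun i => slab r (a i) l) n.
rewrite /Vol4 (le_trans (h _ _ _))//.
- by move=> i _; exact: measurable_slab.
- by move=> p /EU; rewrite bigcup_mkord.
rewrite (eq_bigr (fun=> (l * (2 * r) ^+ 3)%:E)); last by move=> i _; exact: Vol4_slab.
by rewrite sumEFin sumr_const card_ord -[_ *+ n]mulr_natl mulrA.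
Qed.

End volume.

(** * One-variable estimates *)

Section real_analysis.
Context {R : realType}.
Implicit Types (x y t m M : R) (f df : R -> R).

Lemma mean_value f df : (forall x, is_derive x 1 f (df x)) ->
  forall x y, exists z, f y - f x = df z * (y - x).
Proof.
move=> fdf.
have cf : continuous f.
  by move=> x; apply: differentiable_continuous; apply/derivable1_diffP.
have growth x y : x <= y -> exists z, f y - f x = df z * (y - x).
  move=> xy; have [z _ ->] := MVT_segment xy (fun z _ => fdf z)
    (continuous_subspaceT cf).
  by exists z.
move=> x y; have [/growth//|/ltW/growth[z fz]] := leP x y.
by exists z; rewrite -opprB fz -mulrN opprB.
Qed.

Lemma is_derive_lipschitz f df M : (forall x, is_derive x 1 f (df x)) ->
  (forall x, `|df x| <= M) -> forall x y, `|f x - f y| <= M * `|x - y|.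
Proof.
move=> fdf dfM x y; have [z ->] := mean_value fdf y x.
by rewrite normrM ler_wpM2r.
Qed.

(** A lower bound m on the derivative makes f surjective by the intermediate
    value theorem, and its inverse Lipschitz with constant 1 / m. *)
Lemma expanding_inverse f df m : (forall x, is_derive x 1 f (df x)) ->
  0 < m -> (forall x, m <= df x) -> exists2 g, continuous g & cancel f g.
Proof.
move=> fdf m0 mdf.
have expand x y : m * `|x - y| <= `|f x - f y|.
  have [z ->] := mean_value fdf y x.
  by rewrite normrM ler_wpM2r// (le_trans (mdf z))// ler_norm.
have grow x y : x <= y -> m * (y - x) <= f y - f x.
  move=> xy; have [z ->] := mean_value fdf x y.
  by rewrite ler_wpM2r ?subr_ge0.
have cf : continuous f.
  by move=> x; apply: differentiable_continuous; apply/derivable1_diffP.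
(* f takes the value t between -a and a, at which it has moved away from f 0 by
   at least the distance from f 0 to t. *)
have surj t : exists x, f x = t.
  pose a := `|t - f 0| / m.
  have a0 : 0 <= a by rewrite divr_ge0// ltW.
  have ma : m * a = `|t - f 0| by rewrite /a mulrC divfK// gt_eqF.
  have aa : - a <= a by lra.
  have fa := grow 0 a a0; have fNa : m * (0 - - a) <= f 0 - f (- a).
    by apply: grow; lra.
  have [|x _ fx] := IVT (v := t) aa (continuous_subspaceT cf); last by exists x.
  have h1 := ler_norm (t - f 0); have h2 := ler_norm (- (t - f 0)).
  rewrite normrN in h2; rewrite ge_min le_max.
  rewrite subr0 in fa; rewrite sub0r opprK in fNa.
  by apply/andP; split; apply/orP; [left|right]; lra.
pose g t := projT1 (cid (surj t)).
have gK t : f (g t) = t by rewrite /g; case: cid.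
exists g => [t|x]; last first.
  have := expand (g (f x)) x.
  by rewrite gK subrr normr0 pmulr_rle0// normr_le0 subr_eq0 => /eqP.
apply/cvgrPdist_le => e e0; near=> s.
rewrite -(ler_pM2l m0) (le_trans (expand _ _))// !gK.
near: s; apply: cvgr_dist_le; [exact: cvg_id|exact: mulr_gt0].
Unshelve. all: by end_near. Qed.

Lemma sin_lipschitz x y : `|sin x - sin y| <= `|x - y|.
Proof.
rewrite -[leRHS]mul1r; apply: (is_derive_lipschitz (df := cos)) => z.
exact: cos_max.
Qed.

Lemma cos_lipschitz x y : `|cos x - cos y| <= `|x - y|.
Proof.
rewrite -[leRHS]mul1r; apply: (is_derive_lipschitz (df := fun z => - sin z)) => z.
by rewrite normrN sin_max.
Qed.

Lemma atan_lipschitz x y : `|atan x - atan y| <= `|x - y|.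
Proof.
rewrite -[leRHS]mul1r; apply: (is_derive_lipschitz (df := fun z => (1 + z ^+ 2)^-1)) => z.
rewrite ger0_norm; last by rewrite invr_ge0 addr_ge0 ?sqr_ge0.
by rewrite invf_le1 ?ltr_pwDl ?sqr_ge0// lerDl sqr_ge0.
Qed.

Lemma norm_atan_le x : `|atan x| <= `|x|.
Proof. by have := atan_lipschitz x 0; rewrite atan0 !subr0. Qed.

Lemma norm_sin_le x : `|sin x| <= `|x|.
Proof. by have := sin_lipschitz x 0; rewrite sin0 !subr0. Qed.

(** From 1 - cos x = 2 sin (x / 2) ^ 2 and |sin y| <= |y|. *)
Lemma onemcos_le x : 1 - cos x <= x ^+ 2.
Proof.
have -> : x = (x / 2) *+ 2 by rewrite -mulr_natr divfK.
rewrite cos_mulr2n cos2sin2.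
have := norm_sin_le (x / 2); rewrite -ler_sqr ?nnegrE// !real_normK ?num_real//.
by set a := sin _; set b := x / 2; rewrite !mulr2n => ab; nra.
Qed.

(** The left-hand side is atan (1 / x). *)
Lemma pihalf_sub_atan_le x : 0 < x -> pi / 2 - atan x <= x^-1.
Proof.
move=> x0; have xV0 : 0 < x^-1 by rewrite invr_gt0.
set a := atan x^-1.
have a0 : 0 < a by rewrite /a -atan0 lt_atan.
have a1 : a < pi / 2 by exact: atan_ltpi2.
have ta : sin a / cos a = x^-1 by exact: atanK.
have ca : 0 < cos a by apply: cos_gt0_pihalf; rewrite a1 andbT; lra.
have sa : 0 < sin a.
  have <- : x^-1 * cos a = sin a by rewrite -ta divfK ?gt_eqF.
  exact: mulr_gt0.
have -> : atan x = pi / 2 - a.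
  rewrite -[RHS]tanK; last first.
    by rewrite in_itv /=; apply/andP; split; [lra|rewrite ltrBlDr ltrDl].
  congr atan; rewrite /tan sinB cosB sin_pihalf cos_pihalf.
  rewrite !mul0r mul1r subr0 add0r mul1r -[x]invrK -ta.
  by field; rewrite !gt_eqF.
rewrite opprB addrC subrK.
by have := norm_atan_le x^-1; rewrite -/a !gtr0_norm.
Qed.

Lemma sin_periodz x (k : int) : sin (x + pi *+ 2 *~ k) = sin x.
Proof.
case: k => n /=; first by rewrite -pmulrn (periodicn (@sinD2pi R)).
rewrite NegzE mulrNz -[in RHS](subrK (pi *+ 2 *~ n.+1) x) -pmulrn.
by rewrite (periodicn (@sinD2pi R)).
Qed.

Lemma cos_periodz x (k : int) : cos (x + pi *+ 2 *~ k) = cos x.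
Proof.
case: k => n /=; first by rewrite -pmulrn (periodicn (@cosD2pi R)).
rewrite NegzE mulrNz -[in RHS](subrK (pi *+ 2 *~ n.+1) x) -pmulrn.
by rewrite (periodicn (@cosD2pi R)).
Qed.

Lemma angle_reduction x : exists k : int, `|x - pi *+ 2 *~ k| <= pi.
Proof.
have p0 := pi_gt0 R.
exists (Num.floor ((x + pi) / (pi *+ 2))); set k := Num.floor _.
have : k%:~R <= (x + pi) / (pi *+ 2) < (k + 1)%:~R by exact: floor_itv.
rewrite rmorphD /= -[pi *+ 2 *~ k]mulrzl; set w := (x + pi) / _ => /andP[kw wk].
have xw : x + pi = w * (pi *+ 2) by rewrite divfK// gt_eqF// pmulrn_lgt0.
rewrite mulr2n in xw *; rewrite ler_norml; apply/andP; split; nra.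
Qed.

End real_analysis.

(** * A circle map with a neck *)

Section neck.
Context {R : realType}.
Implicit Types (lam c s t : R).

(** The second summand is, up to the factor 1 - lam, the Poisson kernel
    2c / (1 + c^2 + (1 - c^2) cos s), of integral 2 pi over a period, which
    concentrates at s = pi when c tends to 0. *)
Definition neck_slope lam c s : R :=
  lam + (1 - lam) * (2 * c / (1 + c ^+ 2 + (1 - c ^+ 2) * cos s)).

(** The primitive of [neck_slope], written without branches: the argument of atan
    is the tangent of s / 2 - atan (c tan (s / 2)), so that s minus twice the
    value of atan is a continuous lift of the circle map which multiplies
    tan (s / 2) by c.  The convex combination with the identity, of weight lam,
    keeps the slope above lam. *)
Definition neck lam c s : R :=
  s - 2 * (1 - lam) * atan ((1 - c) * sin s / (1 + c + (1 - c) * cos s)).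

Lemma neck_den_ge c s : 0 < c < 1 ->
  2 * c ^+ 2 <= 1 + c ^+ 2 + (1 - c ^+ 2) * cos s.
Proof.
move=> /andP[c0 c1]; have := cos_geN1 s; rewrite !expr2.
set C := cos s => hC; have : 0 <= (1 - c * c) * (C + 1) by apply: mulr_ge0; nra.
by lra.
Qed.

Lemma neck_den_gt0 c s : 0 < c < 1 -> 0 < 1 + c ^+ 2 + (1 - c ^+ 2) * cos s.
Proof.
move=> c01; apply: lt_le_trans (neck_den_ge s c01).
by case/andP: c01 => c0 _; rewrite mulr_gt0// exprn_gt0.
Qed.

Lemma neck_atan_den_gt0 c s : 0 < c < 1 -> 0 < 1 + c + (1 - c) * cos s.
Proof. by move=> /andP[c0 c1]; have := cos_geN1 s; nra. Qed.

Lemma is_derive_neck lam c s : 0 < c < 1 ->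
  is_derive s 1 (neck lam c) (neck_slope lam c s).
Proof.
move=> c01; have D0 := neck_atan_den_gt0 s c01; have Q0 := neck_den_gt0 s c01.
have dS : is_derive s 1 (fun t => (1 - c) * sin t) ((1 - c) * cos s).
  exact: is_deriveZ.
have dC : is_derive s 1 (fun t => 1 + c + (1 - c) * cos t) ((1 - c) * - sin s).
  have h := is_deriveD (is_derive_cst (1 + c) s (1:R))
    (is_deriveZ (1 - c) (is_derive_cos s)).
  by apply: (is_derive_eq h); rewrite add0r.
have dV := is_deriveV (f := fun t => 1 + c + (1 - c) * cos t) (lt0r_neq0 D0) dC.
have dG := is_deriveM dS dV.
have dA := is_derive1_comp (is_derive1_atan _) dG.
have dU := is_deriveB (is_derive_id s (1:R)) (is_deriveZ (2 * (1 - lam)) dA).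
apply: (is_derive_eq dU).
rewrite /neck_slope /GRing.scale /=.
set g := ((fun t => (1 - c) * sin t) * _) s.
have -> : g = (1 - c) * sin s / (1 + c + (1 - c) * cos s) by [].
have S2 := sin2cos2 s; move: D0 Q0 S2; clear.
set C := cos s; set S := sin s => D0 Q0 S2.
have D1 := lt0r_neq0 D0; have Q1 := lt0r_neq0 Q0.
have -> : 1 + ((1 - c) * S / (1 + c + (1 - c) * C)) ^+ 2 =
    2 * (1 + c ^+ 2 + (1 - c ^+ 2) * C) / (1 + c + (1 - c) * C) ^+ 2.
  by rewrite !exprMn S2; field.
have -> : (1 - c) * S * (- (1 + c + (1 - c) * C) ^- 2 * ((1 - c) * - S)) =
    (1 - c) ^+ 2 * (1 - C ^+ 2) / (1 + c + (1 - c) * C) ^+ 2.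
  by rewrite -S2; field.
by field; rewrite D1 Q1.
Qed.

Lemma neck_slope_ge lam c s : 0 < c < 1 -> lam <= 1 -> lam <= neck_slope lam c s.
Proof.
move=> c01 lam1; rewrite lerDl mulr_ge0 ?subr_ge0//.
rewrite divr_ge0 ?(ltW (neck_den_gt0 _ _))//.
by case/andP: c01 => c0 _; rewrite mulr_ge0// ltW.
Qed.

Lemma neck_slope_le lam c s : 0 < c < 1 -> 0 <= lam <= 1 -> neck_slope lam c s <= c^-1.
Proof.
move=> c01 /andP[lam0 lam1]; have /andP[c0 c1] := c01.
have cV : 1 <= c^-1 by rewrite invf_ge1// ltW.
suff : 2 * c / (1 + c ^+ 2 + (1 - c ^+ 2) * cos s) <= c^-1.
  by rewrite /neck_slope; set P := 2 * c / _ => h; nra.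
rewrite ler_pdivrMr ?neck_den_gt0// ler_pdivlMl//.
by rewrite mulrCA -expr2 neck_den_ge.
Qed.

(** Writing q for the denominator of the Poisson kernel, the inverse of the
    slope is q / (lam q + k) with k = 2 c (1 - lam).  Its variation is that
    of q times k / ((lam q + k) (lam q' + k)), hence at most 1 / k times that
    of q.  This is the estimate that makes the total Lipschitz constant of
    order 1 / c instead of 1 / c^2. *)
Lemma neck_slope_inv_lipschitz lam c s t : 0 < c < 1 -> 0 < lam <= 2^-1 ->
  `|(neck_slope lam c s)^-1 - (neck_slope lam c t)^-1| <= c^-1 * `|s - t|.
Proof.
move=> c01 /andP[lam0 lam1].
have /andP[c0 c1] := c01; rewrite /neck_slope.
have invE u : (lam + (1 - lam) * (2 * c / (1 + c ^+ 2 + (1 - c ^+ 2) * cos u)))^-1 =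
  (1 + c ^+ 2 + (1 - c ^+ 2) * cos u) /
  (lam * (1 + c ^+ 2 + (1 - c ^+ 2) * cos u) + (1 - lam) * (2 * c)).
  have Q0 := neck_den_gt0 u c01.
  have : 0 < lam * (1 + c ^+ 2 + (1 - c ^+ 2) * cos u) + (1 - lam) * (2 * c).
    by apply: addr_gt0; apply: mulr_gt0 => //; lra.
  move=> /lt0r_neq0 h; field.
  by rewrite h (lt0r_neq0 Q0).
rewrite !invE.
have Qs := neck_den_gt0 s c01; have Qt := neck_den_gt0 t c01.
have ts := cos_lipschitz s t.
move: Qs Qt ts; set a := cos s; set b := cos t.
have C2 : 0 <= 1 - c ^+ 2 <= 1 by rewrite expr2; nra.
set x := 1 + _ + _ * a; set y := 1 + _ + _ * b => x0 y0 ab.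
have xy : `|x - y| <= `|s - t|.
  have -> : x - y = (1 - c ^+ 2) * (a - b) by rewrite /x /y; ring.
  rewrite normrM (le_trans _ ab)// ler_piMl// ger0_norm//; by case/andP: C2.
set k := (1 - lam) * (2 * c).
have kc : c <= k by rewrite /k; nra.
have k0 : 0 < k by lra.
have dx : k <= lam * x + k by rewrite lerDr mulr_ge0// ltW.
have dy : k <= lam * y + k by rewrite lerDr mulr_ge0// ltW.
have -> : x / (lam * x + k) - y / (lam * y + k) =
    (k / ((lam * x + k) * (lam * y + k))) * (x - y).
  by field; apply/andP; split; apply: lt0r_neq0; lra.
rewrite normrM ler_pM// ger0_norm; last by rewrite divr_ge0 ?mulr_ge0//; lra.
rewrite ler_pdivrMr; last by apply: mulr_gt0; lra.
rewrite ler_pdivlMl//.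
by apply: ler_pM => //; lra.
Qed.

Lemma neck_period lam c s (k : int) :
  neck lam c (s + pi *+ 2 *~ k) = neck lam c s + pi *+ 2 *~ k.
Proof. by rewrite /neck sin_periodz cos_periodz addrAC. Qed.

(** Addition formula for the tangent: h - atan (c tan h) has the tangent that
    occurs in [neck], and lies in the range where atan inverts tan. *)
Lemma neck_half_angle lam c h : 0 < c < 1 -> `|h| < pi / 2 ->
  neck lam c (2 * h) = lam * (2 * h) + 2 * (1 - lam) * atan (c * tan h).
Proof.
move=> c01 hpi; have /andP[c0 c1] := c01; move: (hpi); rewrite ltr_norml => /andP[h1 h2].
have C0 : 0 < cos h by apply: cos_gt0_pihalf; rewrite h1 h2.
have hK : h = atan (tan h) by rewrite tanK// in_itv /= h1 h2.
have [a1 a2] : - (pi / 2) < h - atan (c * tan h) /\ h - atan (c * tan h) < pi / 2.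
  have [t0|t0] := leP 0 (tan h).
    have l0 : 0 <= atan (c * tan h) by rewrite -atan0 le_atan// mulr_ge0// ltW.
    have l1 : atan (c * tan h) <= h by rewrite [leRHS]hK le_atan// ler_piMl// ltW.
    by split; lra.
  have l0 : atan (c * tan h) <= 0 by rewrite -atan0 le_atan// nmulr_lle0// ltW.
  have l1 : h <= atan (c * tan h) by rewrite [leLHS]hK le_atan// ler_niMl// ltW.
  by split; lra.
have Ca : cos (atan (c * tan h)) != 0.
  by rewrite gt_eqF// cos_gt0_pihalf// atan_gtNpi2 atan_ltpi2.
rewrite /neck; suff -> : (1 - c) * sin (2 * h) / (1 + c + (1 - c) * cos (2 * h)) =
    tan (h - atan (c * tan h)).
  rewrite tanK; last by rewrite in_itv /= a1 a2.
  by ring.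
rewrite tanD ?cosN ?(lt0r_neq0 C0)// tanN atanK.
rewrite !mulr_natl sin_mulr2n cos_mulr2n /tan.
have S2 := sin2cos2 h; move: C0 S2; set C := cos h; set S := sin h => C0 S2.
have D0 : C ^+ 2 + c * S ^+ 2 != 0.
  by rewrite gt_eqF// ltr_pwDl ?exprn_gt0// mulr_ge0 ?sqr_ge0// ltW.
have D1 : 1 + c + (1 - c) * (C ^+ 2 *+ 2 - 1) = 2 * (C ^+ 2 + c * S ^+ 2).
  by rewrite S2; ring.
have D2 : C * C - S * - (c * S) = C ^+ 2 + c * S ^+ 2 by ring.
by rewrite D1; field; rewrite D2 D0 (lt0r_neq0 C0).
Qed.

(** Away from the necks |c tan (t / 2)| <= lam, so the circle map moves t to
    within 2 lam of 0; the linear term contributes at most pi lam. *)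
Lemma neck_plateau lam c t : 0 < c < 1 -> 0 < lam <= 1 ->
  `|t| <= 2 * atan (lam / c) -> `|neck lam c t| <= 6 * lam.
Proof.
move=> c01 /andP[lam0 lam1] tM; have /andP[c0 c1] := c01.
have p4 : pi < 4 :> R by have := pihalf_lt2 R; lra.
have M0 : 0 < lam / c by rewrite divr_gt0.
have aM := atan_ltpi2 (lam / c).
have [h th] : exists h, t = 2 * h by exists (t / 2); field.
rewrite {t}th in tM *.
have hM : `|h| <= atan (lam / c) by rewrite normrM normr_nat ler_pM2l in tM.
have hpi : `|h| < pi / 2 by exact: le_lt_trans aM.
have yM : `|tan h| <= lam / c.
  have : h = atan (tan h) by rewrite tanK// in_itv /= -ltr_norml.
  set y := tan h => hy; move: hM; rewrite hy !ler_norml => /andP[m1 m2].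
  apply/andP; split; rewrite leNgt; apply/negP => /lt_atan.
    by rewrite atanN; lra.
  by lra.
rewrite neck_half_angle// (le_trans (ler_normD _ _))//.
have cy : `|c * tan h| <= lam.
  by rewrite normrM gtr0_norm// mulrC -ler_pdivlMr.
have := le_trans (norm_atan_le (c * tan h)) cy; set A := atan (c * _) => hA.
rewrite !normrM !normr_nat (gtr0_norm lam0) (ger0_norm (_ : 0 <= 1 - lam)); last lra.
have lh : lam * `|h| <= lam * 2 by rewrite ler_pM2l//; lra.
have lA : (1 - lam) * `|A| <= 1 * lam by apply: ler_pM => //; lra.
by lra.
Qed.

(** The complement of the plateaux has half-width pi - 2 atan (lam / c) around
    the odd multiples of pi, that is 2 atan (c / lam) <= 2 c / lam. *)
Lemma neck_angle_cover lam c s : 0 < c -> 0 < lam -> exists k : int,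
  `|s - pi *+ 2 *~ k| <= 2 * atan (lam / c) \/
  `|s - (pi + pi *+ 2 *~ k)| <= 2 * (c / lam).
Proof.
move=> c0 lam0; have [k sk] := angle_reduction s.
have M0 : 0 < lam / c by rewrite divr_gt0.
have := pihalf_sub_atan_le M0; rewrite invf_div => aM.
have [|sM] := leP `|s - pi *+ 2 *~ k| (2 * atan (lam / c)); first by exists k; left.
move: sk; rewrite ler_norml => /andP[s1 s2].
have [t0|t0] := leP 0 (s - pi *+ 2 *~ k).
  exists k; right; rewrite ger0_norm// in sM.
  by rewrite ler_norml; apply/andP; split; lra.
exists (k - 1); right; rewrite ltr0_norm// in sM.
rewrite mulrzBr mulr1z mulr2n in s1 s2 sM t0 *.
by rewrite ler_norml; apply/andP; split; lra.
Qed.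

End neck.

(** * Lipschitz constants, area-preserving stretches and shears *)

Section lipschitz_maps.
Context {R : realType}.
Implicit Types (p q : R4 R) (U V : set (R4 R)) (F G : R4 R -> R4 R).

Lemma coord_le_enorm p :
  [/\ `|x1 p| <= enorm p, `|y1 p| <= enorm p, `|x2 p| <= enorm p & `|y2 p| <= enorm p].
Proof.
have [a b c d] : [/\ 0 <= x1 p ^+ 2, 0 <= y1 p ^+ 2, 0 <= x2 p ^+ 2 & 0 <= y2 p ^+ 2].
  by split; exact: sqr_ge0.
by split; rewrite -sqrtr_sqr /enorm ler_wsqrtr//; lra.
Qed.

Lemma open_ball_coords (r : R) p : open_ball r p ->
  [/\ `|x1 p| <= r, `|y1 p| <= r, `|x2 p| <= r & `|y2 p| <= r].
Proof.
move=> /ltW pr; have [h1 h2 h3 h4] := coord_le_enorm p.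
by split; exact: le_trans pr.
Qed.

Lemma enorm_le_sum p : enorm p <= `|x1 p| + `|y1 p| + `|x2 p| + `|y2 p|.
Proof.
have [a b c d] : [/\ 0 <= `|x1 p|, 0 <= `|y1 p|, 0 <= `|x2 p| & 0 <= `|y2 p|] by [].
have sqrE (x : R) : x ^+ 2 = `|x| ^+ 2 by rewrite real_normK ?num_real.
rewrite -[leRHS]ger0_norm; last by rewrite !addr_ge0.
rewrite -sqrtr_sqr /enorm ler_wsqrtr//.
rewrite (sqrE (x1 p)) (sqrE (y1 p)) (sqrE (x2 p)) (sqrE (y2 p)).
move: a b c d; move: `|x1 p| `|y1 p| `|x2 p| `|y2 p| => u v w z a b c d.
have uv := mulr_ge0 a b; have uw := mulr_ge0 a c; have uz := mulr_ge0 a d.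
have vw := mulr_ge0 b c; have vz := mulr_ge0 b d; have wz := mulr_ge0 c d.
by rewrite !expr2; lra.
Qed.

Lemma lipschitz_coords (a b c d : R) U F :
  (forall p q, U p -> U q ->
    [/\ `|x1 (F p) - x1 (F q)| <= a * enorm (p - q),
        `|y1 (F p) - y1 (F q)| <= b * enorm (p - q),
        `|x2 (F p) - x2 (F q)| <= c * enorm (p - q)
      & `|y2 (F p) - y2 (F q)| <= d * enorm (p - q)]) ->
  lipschitz_at_most (a + b + c + d) U F.
Proof.
move=> h p q Up Uq; have [h1 h2 h3 h4] := h p q Up Uq.
rewrite (le_trans (enorm_le_sum _))// !mulrDl.
by rewrite !lerD.
Qed.

Lemma lipschitz_comp (K L : R) U V F G : 0 <= L ->
  lipschitz_at_most K U F -> lipschitz_at_most L V G ->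
  (forall p, U p -> V (F p)) -> lipschitz_at_most (L * K) U (fun p => G (F p)).
Proof.
move=> L0 lF lG UV p q Up Uq.
rewrite (le_trans (lG _ _ (UV p Up) (UV q Uq)))// -mulrA.
by rewrite ler_wpM2l// lF.
Qed.

Lemma lipschitz_at_most_le (K L : R) U F : K <= L ->
  lipschitz_at_most K U F -> lipschitz_at_most L U F.
Proof.
move=> KL lF p q Up Uq; rewrite (le_trans (lF p q Up Uq))// ler_wpM2r//.
exact: sqrtr_ge0.
Qed.

Lemma lipschitz_mul (u v u' v' A B a b n : R) :
  `|u| <= A -> `|v'| <= B -> `|u - u'| <= a * n -> `|v - v'| <= b * n ->
  0 <= n -> 0 <= b ->
  `|u * v - u' * v'| <= (A * b + B * a) * n.
Proof.
move=> uA vB uu vv n0 b0.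
have -> : u * v - u' * v' = u * (v - v') + v' * (u - u') by ring.
rewrite (le_trans (ler_normD _ _))// !normrM mulrDl -!mulrA.
by apply: lerD; apply: ler_pM.
Qed.

End lipschitz_maps.

Section planar_maps.
Context {R : realType}.
Implicit Types (p : R4 R) (s t m M B : R) (phi dphi : R -> R).

(** Conjugation by [swap] exchanges the roles of the two symplectic planes. *)
Definition swap p : R4 R := (x2 p, y2 p, x1 p, y1 p).

Definition stretch phi dphi p : R4 R :=
  (phi (x1 p), (dphi (x1 p))^-1 * y1 p, x2 p, y2 p).

(** The time-one flow of the Hamiltonian phi(x1) * y2, when dphi = phi'. *)
Definition shear phi dphi p : R4 R :=
  (x1 p, y1 p - dphi (x1 p) * y2 p, x2 p + phi (x1 p), y2 p).

Lemma is_diff_preserves_omega (F : R4 R -> R4 R) (dF : R4 R -> R4 R -> R4 R) :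
  (forall p, is_diff p F (dF p)) ->
  (forall p u v, omega (dF p u) (dF p v) = omega u v) -> preserves_omega F.
Proof. by move=> FdF h p u v; have Dp := FdF p; rewrite diff_val. Qed.

Lemma identity_symplectomorphism : elementary_symplectomorphism (fun p : R4 R => p).
Proof.
split; first by split; constructor.
- by apply: (is_diff_preserves_omega (dF := fun=> id)) => p //; exact: is_diff_id.
- by exists id => // p; exact: cvg_id.
Qed.

Lemma swap_symplectomorphism : elementary_symplectomorphism swap.
Proof.
split.
- split; constructor.
- apply: (is_diff_preserves_omega (dF := fun=> swap)) => [p|p u v]; last first.
    by rewrite /omega /swap /x1 /y1 /x2 /y2 /=; ring.
  exact: (is_diff_coords (F := swap) (dF := swap) (is_diff_x2 p)
    (is_diff_y2 p) (is_diff_x1 p) (is_diff_y1 p)).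
- exists swap => [|[[[]]]//].
  by apply: elementary_map_continuous; split; constructor.
Qed.

Lemma is_derive_derive1 phi t : derivable phi t 1 -> is_derive t 1 phi (derive1 phi t).
Proof. by move=> dphi; rewrite derive1E; exact: derivableP. Qed.

Lemma shear_elementary phi dphi : elementary (fun p => phi (x1 p)) ->
  elementary (fun p => dphi (x1 p)) -> elementary_map (shear phi dphi).
Proof.
move=> e0 e1; split; rewrite /shear /x1 /y1 /x2 /y2 /=.
- exact: elementary_x1.
- apply: elementaryB; first exact: elementary_y1.
  by apply: elementaryM => //; exact: elementary_y2.
- apply: elementaryD => //; exact: elementary_x2.
- exact: elementary_y2.
Qed.

Lemma shear_symplectomorphism phi dphi :
  elementary (fun p => phi (x1 p)) -> elementary (fun p => dphi (x1 p)) ->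
  (forall t, is_derive t 1 phi (dphi t)) -> (forall t : R, derivable dphi t 1) ->
  elementary_symplectomorphism (shear phi dphi).
Proof.
move=> e0 e1 dp ddp; split; first exact: shear_elementary.
- pose dF p u := (x1 u,
    y1 u - (dphi (x1 p) * y2 u + y2 p * (derive1 dphi (x1 p) * x1 u)),
    x2 u + dphi (x1 p) * x1 u, y2 u).
  apply: (is_diff_preserves_omega (dF := dF)) => [p|p u v]; last first.
    by rewrite /omega /dF /x1 /y1 /x2 /y2 /=; ring.
  have d1 := is_diff_comp1 (dp (x1 p)) (is_diff_x1 p).
  have d2 := is_diff_comp1 (is_derive_derive1 (ddp (x1 p))) (is_diff_x1 p).
  have d3 := is_diffB (is_diff_y1 p) (is_diffM d2 (is_diff_y2 p)).
  have d4 := is_diffD (is_diff_x2 p) d1.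
  exact: (is_diff_coords (F := shear phi dphi) (dF := dF p)
    (is_diff_x1 p) d3 d4 (is_diff_y2 p)).
- exists (shear (fun t => - phi t) (fun t => - dphi t)).
    by apply: elementary_map_continuous; apply: shear_elementary; exact: elementaryN.
  by move=> [[[a b] c] d]; rewrite /shear /x1 /y1 /x2 /y2 /=; congr (_, _, _, _); ring.
Qed.

Lemma stretch_symplectomorphism phi dphi m : 0 < m -> (forall t, m <= dphi t) ->
  elementary (fun p => phi (x1 p)) -> elementary (fun p => dphi (x1 p)) ->
  (forall t, is_derive t 1 phi (dphi t)) -> (forall t : R, derivable dphi t 1) ->
  elementary_symplectomorphism (stretch phi dphi).
Proof.
move=> m0 mdphi e0 e1 dp ddp.
have dphi0 t : dphi t != 0 by rewrite gt_eqF// (lt_le_trans m0).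
split.
- split; rewrite /stretch /x1 /y1 /x2 /y2 /= => //;
    [|exact: elementary_x2|exact: elementary_y2].
  apply: elementaryM; last exact: elementary_y1.
  exact: elementaryV.
- pose dF p u := (dphi (x1 p) * x1 u,
    (dphi (x1 p))^-1 * y1 u
      + y1 p * (- (dphi (x1 p)) ^- 2 * (derive1 dphi (x1 p)) * x1 u),
    x2 u, y2 u).
  apply: (is_diff_preserves_omega (dF := dF)) => [p|p u v]; last first.
    rewrite /omega /dF; have := dphi0 (x1 p).
    set d := dphi _; set e := derive1 dphi _ => d0.
    by rewrite /x1 /y1 /x2 /y2 /=; field.
  have d1 := is_diff_comp1 (dp (x1 p)) (is_diff_x1 p).
  have d2 := is_diff_comp1 (is_deriveV (dphi0 (x1 p))
    (is_derive_derive1 (ddp (x1 p)))) (is_diff_x1 p).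
  have d3 := is_diffM d2 (is_diff_y1 p).
  exact: (is_diff_coords (F := stretch phi dphi) (dF := dF p) d1 d3
    (is_diff_x2 p) (is_diff_y2 p)).
- have [psi cpsi psiK] := expanding_inverse dp m0 mdphi.
  exists (fun p => (psi (x1 p), dphi (psi (x1 p)) * y1 p, x2 p, y2 p)); last first.
    move=> [[[a b] c] d]; rewrite /stretch /x1 /y1 /x2 /y2 /= psiK.
    by congr (_, _, _, _); rewrite mulrA divff ?mul1r.
  have cdphi : continuous dphi.
    by move=> t; apply: differentiable_continuous; exact/derivable1_diffP.
  have cont (F : R4 R -> R) : elementary F -> continuous F.
    move=> /elementary_diff[dF [D _]] p; have Dp := D p.
    by apply: differentiable_continuous; exact: ex_diff.
  move=> p.
  have c1 : psi (x1 q) @[q --> p] --> psi (x1 p).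
    by apply: continuous_comp; [exact: (cont _ elementary_x1)|exact: cpsi].
  have c2 : dphi (psi (x1 q)) @[q --> p] --> dphi (psi (x1 p)).
    by apply: (continuous_comp (f := fun q => psi (x1 q))) => //; exact: cdphi.
  have c3 : dphi (psi (x1 q)) * y1 q @[q --> p] --> dphi (psi (x1 p)) * y1 p.
    by apply: cvgM => //; exact: (cont _ elementary_y1).
  have cx2 := cont _ elementary_x2 p; have cy2 := cont _ elementary_y2 p.
  exact: (cvg_pair (cvg_pair (cvg_pair c1 c3) cx2) cy2).
Qed.

Lemma swap_lipschitz U : lipschitz_at_most 1 U swap.
Proof.
move=> p q _ _; rewrite mul1r /enorm /swap /x1 /y1 /x2 /y2 /=.
by rewrite le_eqVlt; apply/orP; left; apply/eqP; congr Num.sqrt; ring.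
Qed.

Lemma shear_lipschitz phi dphi (M B : R) : 0 <= M ->
  (forall s t, `|phi s - phi t| <= M * `|s - t|) ->
  (forall t, `|dphi t| <= M) ->
  (forall s t, `|dphi s - dphi t| <= M * `|s - t|) ->
  lipschitz_at_most (4 + 2 * M + M * B) [set p | `|y2 p| <= B] (shear phi dphi).
Proof.
move=> M0 lphi bdphi ldphi.
have -> : 4 + 2 * M + M * B = 1 + (1 + (M * 1 + B * M)) + (1 + M) + 1 by ring.
apply: lipschitz_coords => p q /= Bp Bq.
have [n1 n2 n3 n4] := coord_le_enorm (p - q).
have n0 : 0 <= enorm (p - q) by exact: sqrtr_ge0.
have lx (psi : R -> R) : (forall s t, `|psi s - psi t| <= M * `|s - t|) ->
    `|psi (x1 p) - psi (x1 q)| <= M * enorm (p - q).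
  by move=> /(_ (x1 p) (x1 q)) /le_trans -> //; rewrite ler_wpM2l.
rewrite /shear {1 2}/x1 {1 2}/y1 {1 2}/x2 {1 2}/y2 /= !mul1r; split => //.
- have -> : y1 p - dphi (x1 p) * y2 p - (y1 q - dphi (x1 q) * y2 q) =
    y1 (p - q) - (dphi (x1 p) * y2 p - dphi (x1 q) * y2 q).
    by rewrite /y1 /=; ring.
  rewrite (le_trans (ler_normB _ _))// mulrDl mul1r lerD//.
  by apply: lipschitz_mul => //; [exact: lx|rewrite mul1r].
- have -> : x2 p + phi (x1 p) - (x2 q + phi (x1 q)) =
    x2 (p - q) + (phi (x1 p) - phi (x1 q)).
    by rewrite /x2 /=; ring.
  by rewrite (le_trans (ler_normD _ _))// mulrDl mul1r lerD// lx.
Qed.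

Lemma stretch_lipschitz phi dphi (M B : R) : 1 <= M ->
  (forall s t, `|phi s - phi t| <= M * `|s - t|) ->
  (forall t, `|(dphi t)^-1| <= M) ->
  (forall s t, `|(dphi s)^-1 - (dphi t)^-1| <= M * `|s - t|) ->
  lipschitz_at_most ((4 + B) * M) [set p | `|y1 p| <= B] (stretch phi dphi).
Proof.
move=> M1 lphi bdphi ldphi.
apply: (@lipschitz_at_most_le _ (M + (M * 1 + B * M) + 1 + 1)); first by nra.
apply: lipschitz_coords => p q /= Bp Bq.
have [n1 n2 n3 n4] := coord_le_enorm (p - q).
have n0 : 0 <= enorm (p - q) by exact: sqrtr_ge0.
have lx (psi : R -> R) : (forall s t, `|psi s - psi t| <= M * `|s - t|) ->
    `|psi (x1 p) - psi (x1 q)| <= M * enorm (p - q).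
  by move=> /(_ (x1 p) (x1 q)) /le_trans -> //; rewrite ler_wpM2l//; lra.
rewrite !mul1r; split => //; first exact: lx.
by apply: lipschitz_mul => //; [exact: (lx (fun t => (dphi t)^-1))|rewrite mul1r].
Qed.

End planar_maps.

(** * The squeezing map *)

Section twist.
Context {R : realType}.
Implicit Types (a m s t : R).

(** A smooth staircase: its slope vanishes to second order at the multiples of
    2 pi / m, and it climbs by 2 pi a over each period. *)
Definition twist a m t : R := a * (m * t - sin (m * t)).
Definition twist_slope a m t : R := a * m * (1 - cos (m * t)).

Lemma is_derive_linear m t : is_derive t 1 (fun s : R => m * s) m.
Proof.
have h := is_deriveZ m (is_derive_id t (1 : R)).
by apply: (is_derive_eq h); rewrite /GRing.scale /= mulr1.
Qed.

Lemma is_derive_twist a m t : is_derive t 1 (twist a m) (twist_slope a m t).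
Proof.
have dm := is_derive_linear m t.
have h := is_deriveZ a (is_deriveB dm (is_derive1_comp (is_derive_sin (m * t)) dm)).
by apply: (is_derive_eq h); rewrite /twist_slope /GRing.scale /=; ring.
Qed.

Lemma derivable_twist_slope a m t : derivable (twist_slope a m) t 1.
Proof.
have dm := is_derive_linear m t.
have h := is_deriveZ (a * m) (is_deriveB (is_derive_cst (1 : R) t (1 : R))
  (is_derive1_comp (is_derive_cos (m * t)) dm)).
exact: (@ex_derive _ _ _ _ _ _ _ h).
Qed.

Lemma twist_slope_bound a m t : `|twist_slope a m t| <= 2 * `|a * m|.
Proof.
rewrite /twist_slope normrM mulrC ler_wpM2r// ler_norml.
have := cos_geN1 (m * t); have := cos_le1 (m * t).
by move=> h1 h2; apply/andP; split; lra.
Qed.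

Lemma twist_lipschitz a m s t : `|twist a m s - twist a m t| <= 2 * `|a * m| * `|s - t|.
Proof.
by apply: (is_derive_lipschitz (is_derive_twist a m)); exact: twist_slope_bound.
Qed.

Lemma twist_slope_lipschitz a m s t :
  `|twist_slope a m s - twist_slope a m t| <= `|a * m| * `|m| * `|s - t|.
Proof.
have -> : twist_slope a m s - twist_slope a m t =
    (a * m) * (cos (m * t) - cos (m * s)) by rewrite /twist_slope; ring.
rewrite normrM -mulrA ler_wpM2l// (le_trans (cos_lipschitz _ _))//.
by rewrite -mulrBr normrM distrC.
Qed.

Lemma elementaryZ m (f : R4 R -> R) : elementary f -> elementary (fun p => m * f p).
Proof. by move=> ef; apply: elementaryM => //; exact: elementary_cst. Qed.

Definition twist_shear a m := shear (twist a m) (twist_slope a m).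

Lemma twist_shear_symplectomorphism a m : elementary_symplectomorphism (twist_shear a m).
Proof.
have em : elementary (fun p : R4 R => m * x1 p).
  by apply: elementaryZ; exact: elementary_x1.
apply: shear_symplectomorphism.
- by apply: elementaryZ; apply: elementaryB => //; exact: elementary_sin.
- apply: elementaryZ; apply: elementaryB; first exact: elementary_cst.
  exact: elementary_cos.
- exact: is_derive_twist.
- exact: derivable_twist_slope.
Qed.

Definition twist_bound a m := 2 * `|a * m| + `|a * m| * `|m|.

Lemma twist_bound_ge0 a m : 0 <= twist_bound a m.
Proof. by rewrite addr_ge0 ?mulr_ge0. Qed.

Lemma twist_shear_lipschitz a m (B : R) :
  lipschitz_at_most (4 + 2 * twist_bound a m + twist_bound a m * B)
    [set p | `|y2 p| <= B] (twist_shear a m).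
Proof.
have h1 : 0 <= `|a * m| by []. have h2 : 0 <= `|a * m| * `|m| by exact: mulr_ge0.
apply: shear_lipschitz => [|s t|t|s t]; rewrite /twist_bound.
- by lra.
- by rewrite (le_trans (twist_lipschitz _ _ _ _))// ler_wpM2r// lerDl.
- by rewrite (le_trans (twist_slope_bound _ _ _))// lerDl.
- by rewrite (le_trans (twist_slope_lipschitz _ _ _ _))// ler_wpM2r// lerDr; lra.
Qed.

End twist.

Section squeeze.
Context {R : realType}.
(* The parameter lam equals 1 / (100 r); the equation form avoids inverses. *)
Variables (r c lam : R).
Hypotheses (r1 : 1 < r) (c01 : 0 < c < 1) (lamr : 100 * r * lam = 1).

(** The factor 400 r in the frequency makes the strips narrow enough for their
    images to satisfy |y1| <= 1 / 4.  The factor r in front turns the plateau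
    width, of order lam, into a small absolute constant. *)
Definition squeeze_stretch : R4 R -> R4 R :=
  stretch (fun t => r * neck lam c (400 * r * t))
          (fun t => 400 * r ^+ 2 * neck_slope lam c (400 * r * t)).

(** A step of the staircase is 200 pi r^2, much larger than the diameter of the
    ball, so that the fold can tell the strips apart by their height. *)
Definition squeeze_lift : R4 R -> R4 R := twist_shear (100 * r ^+ 2) r^-1.

Definition squeeze_fold (p : R4 R) : R4 R :=
  swap (twist_shear (- r) (100 * r ^+ 2)^-1 (swap p)).

Definition squeeze (p : R4 R) : R4 R := squeeze_fold (squeeze_lift (squeeze_stretch p)).

Let r0 : 0 < r. Proof. exact: lt_trans r1. Qed.
Let lam0 : 0 < lam.
Proof. by rewrite -(pmulr_rgt0 _ (_ : 0 < 100 * r)) ?lamr// mulr_gt0. Qed.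
Let lam_small : 100 * lam <= 1.
Proof.
have : lam <= r * lam by rewrite ler_peMl// ltW.
by move: lamr; rewrite -mulrA; lra.
Qed.
Let lam1 : lam <= 1. Proof. by have := lam_small; lra. Qed.
Let c0 : 0 < c. Proof. by case/andP: c01. Qed.
Let p400 : 0 < 400 :> R. Proof. by rewrite ltr0n. Qed.
Let r400 : 0 < 400 * r. Proof. exact: mulr_gt0. Qed.
Let r2_gt0 : 0 < 400 * r ^+ 2. Proof. by apply: mulr_gt0 => //; exact: exprn_gt0. Qed.

Lemma squeeze_stretch_symplectomorphism : elementary_symplectomorphism squeeze_stretch.
Proof.
have em : elementary (fun p : R4 R => 400 * r * x1 p).
  by apply: elementaryZ; exact: elementary_x1.
have cst (k : R) : elementary (fun=> k) by exact: elementary_cst.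
have dm t := is_derive_linear (400 * r) t.
apply: (@stretch_symplectomorphism _ _ _ (400 * r ^+ 2 * lam)).
- exact: mulr_gt0 r2_gt0 lam0.
- move=> t; apply: ler_wpM2l (ltW r2_gt0) _ _ _.
  exact: neck_slope_ge.
- apply: elementaryZ; rewrite /neck; apply: elementaryB => //.
  apply: elementaryZ; apply: elementary_atan; apply: elementaryM.
    by apply: elementaryZ; exact: elementary_sin.
  apply: elementaryV => [p|]; first by rewrite gt_eqF// neck_atan_den_gt0.
  by apply: elementaryD => //; apply: elementaryZ; exact: elementary_cos.
- apply: elementaryZ; rewrite /neck_slope; apply: elementaryD => //.
  do !apply: elementaryZ.
  apply: elementaryV => [p|]; first by rewrite gt_eqF// neck_den_gt0.
  by apply: elementaryD => //; apply: elementaryZ; exact: elementary_cos.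
- move=> t; have h := is_deriveZ r
    (is_derive1_comp (is_derive_neck lam (400 * r * t) c01) (dm t)).
  by apply: (is_derive_eq h); rewrite /GRing.scale /=; ring.
- move=> t.
  have dC := is_derive1_comp (is_derive_cos (400 * r * t)) (dm t).
  have dQ := is_deriveD (is_derive_cst (1 + c ^+ 2) t (1:R)) (is_deriveZ (1 - c ^+ 2) dC).
  have Q0 := lt0r_neq0 (neck_den_gt0 (400 * r * t) c01).
  have dV := is_deriveV
    (f := fun t => 1 + c ^+ 2 + (1 - c ^+ 2) * cos (400 * r * t)) Q0 dQ.
  have dS := is_deriveD (is_derive_cst lam t (1:R))
    (is_deriveZ (1 - lam) (is_deriveZ (2 * c) dV)).
  exact: (@ex_derive _ _ _ _ _ _ _ (is_deriveZ (400 * r ^+ 2) dS)).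
Qed.

Lemma squeeze_symplectomorphism : elementary_symplectomorphism squeeze.
Proof.
apply: elementary_symplectomorphism_comp.
  apply: elementary_symplectomorphism_comp; first exact: swap_symplectomorphism.
  apply: elementary_symplectomorphism_comp; last exact: swap_symplectomorphism.
  exact: twist_shear_symplectomorphism.
apply: elementary_symplectomorphism_comp; first exact: twist_shear_symplectomorphism.
exact: squeeze_stretch_symplectomorphism.
Qed.

Lemma squeeze_stretch_inv_slope t :
  0 < (400 * r ^+ 2 * neck_slope lam c (400 * r * t))^-1 <= (4 * r)^-1.
Proof.
have h : lam <= neck_slope lam c (400 * r * t) by exact: neck_slope_ge.
have p0 : 0 < 400 * r ^+ 2 * neck_slope lam c (400 * r * t).
  exact: mulr_gt0 r2_gt0 (lt_le_trans lam0 h).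
have r40 : 0 < 4 * r by rewrite mulr_gt0.
rewrite invr_gt0 p0 lef_pV2 ?posrE//.
have -> : 4 * r = 400 * r ^+ 2 * lam.
  have -> : 400 * r ^+ 2 * lam = 4 * r * (100 * r * lam) by ring.
  by rewrite lamr mulr1.
exact: ler_wpM2l (ltW r2_gt0) _ _ h.
Qed.

Lemma squeeze_stretch_lipschitz :
  lipschitz_at_most ((4 + r) * (400 * r ^+ 2 / c)) [set p | `|y1 p| <= r] squeeze_stretch.
Proof.
have /andP[_ c1] := c01.
have cV : 1 < c^-1 by rewrite invf_gt1.
have r2 : 1 < r ^+ 2 by rewrite -[ltLHS](expr1n _ 2) ltr_pXn2r ?nnegrE ?ltW.
have rV : 0 < r^-1 <= 1 by rewrite invr_gt0 r0 invf_le1// ltW.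
have r2c : 1 <= r ^+ 2 / c by rewrite -[leLHS]mulr1 ler_pM// ltW.
apply: stretch_lipschitz.
- by rewrite -mulrA; lra.
- move=> s t; rewrite -mulrBr normrM gtr0_norm//.
  have sl : `|neck lam c (400 * r * s) - neck lam c (400 * r * t)| <=
      c^-1 * `|400 * r * s - 400 * r * t|.
    apply: (is_derive_lipschitz (fun u => is_derive_neck lam u c01)) => u.
    have h : lam <= neck_slope lam c u by exact: neck_slope_ge.
    rewrite ger0_norm; last exact: le_trans (ltW lam0) h.
    by apply: neck_slope_le => //; rewrite ltW.
  rewrite (le_trans (ler_wpM2l (ltW r0) sl))// -mulrBr normrM (gtr0_norm r400).
  by rewrite le_eqVlt; apply/orP; left; apply/eqP; ring.
- move=> t; have /andP[h1 h2] := squeeze_stretch_inv_slope t.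
  rewrite gtr0_norm// (le_trans h2)// invfM -[400 * _ / _]mulrA.
  by move: rV r2c; lra.
- move=> s t; rewrite !invfM -mulrBr normrM.
  have lam2 : 0 < lam <= 2^-1 by rewrite lam0; have := lam_small; lra.
  have sl := @neck_slope_inv_lipschitz _ lam c (400 * r * s) (400 * r * t) c01 lam2.
  rewrite (le_trans (ler_wpM2l _ sl))//.
  have k0 : 0 < 400^-1 * (r^-1 / r).
    by rewrite mulr_gt0 ?invr_gt0 ?p400// mulr_gt0 ?invr_gt0.
  rewrite -mulrBr [`|400 * r * _|]normrM (gtr0_norm r400) (gtr0_norm k0).
  have -> : 400^-1 * (r^-1 / r) * (c^-1 * (400 * r * `|s - t|)) = (r^-1 / c) * `|s - t|.
    by field; rewrite !gt_eqF.
  rewrite ler_wpM2r// -[400 * _ / _]mulrA.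
  by move: rV r2c => /andP[]; nra.
Qed.

Lemma squeeze_stretch_y1 (p : R4 R) : `|y1 p| <= r ->
  `|y1 (squeeze_stretch p)| <= 4^-1.
Proof.
move=> yr; rewrite [y1 _]/=.
have /andP[h1 h2] := squeeze_stretch_inv_slope (x1 p).
have -> : 4^-1 = (4 * r)^-1 * r by rewrite invfM mulfVK// gt_eqF.
by rewrite normrM (gtr0_norm h1); apply: ler_pM => //; exact: ltW.
Qed.

(** A bound for |y1| on the image of the ball under the stretch and the lift. *)
Definition lift_bound : R := 4^-1 + 2 * `|100 * r ^+ 2 / r| * r.

Definition squeeze_lipschitz_factor : R :=
  (4 + 2 * twist_bound (- r) (100 * r ^+ 2)^-1
     + twist_bound (- r) (100 * r ^+ 2)^-1 * lift_bound) *
  ((4 + 2 * twist_bound (100 * r ^+ 2) r^-1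
      + twist_bound (100 * r ^+ 2) r^-1 * r) *
   ((4 + r) * (400 * r ^+ 2))).

Lemma squeeze_fold_lipschitz (B : R) : 0 <= B ->
  lipschitz_at_most (4 + 2 * twist_bound (- r) (100 * r ^+ 2)^-1
    + twist_bound (- r) (100 * r ^+ 2)^-1 * B) [set p | `|y1 p| <= B] squeeze_fold.
Proof.
move=> B0; set K := (X in lipschitz_at_most X).
have K0 : 0 <= K by rewrite !addr_ge0 ?mulr_ge0 ?twist_bound_ge0.
have h1 := lipschitz_comp K0 (@swap_lipschitz R [set p | `|y1 p| <= B])
  (@twist_shear_lipschitz R (- r) (100 * r ^+ 2)^-1 B) (fun p Up => Up).
have h2 := lipschitz_comp ler01 h1 (@swap_lipschitz R setT) (fun _ _ => I).
by rewrite mulr1 mul1r in h2.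
Qed.

Lemma squeeze_lift_y1 (p : R4 R) : `|y1 p| <= r -> `|y2 p| <= r ->
  `|y1 (squeeze_lift (squeeze_stretch p))| <= lift_bound.
Proof.
move=> yr y2r; set q := squeeze_stretch p.
rewrite (_ : y1 _ = y1 q - twist_slope (100 * r ^+ 2) r^-1 (x1 q) * y2 p)//.
rewrite (le_trans (ler_normB _ _))// lerD ?squeeze_stretch_y1// normrM.
by apply: ler_pM => //; exact: twist_slope_bound.
Qed.

Lemma squeeze_lipschitz :
  lipschitz_at_most (squeeze_lipschitz_factor / c) (open_ball r) squeeze.
Proof.
have hA : lipschitz_at_most ((4 + r) * (400 * r ^+ 2 / c)) (open_ball r)
    squeeze_stretch.
  move=> p q /open_ball_coords[_ hp _ _] /open_ball_coords[_ hq _ _].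
  exact: squeeze_stretch_lipschitz.
have F0 : 0 <= 4 + 2 * twist_bound (100 * r ^+ 2) r^-1
    + twist_bound (100 * r ^+ 2) r^-1 * r.
  by rewrite !addr_ge0 ?mulr_ge0 ?twist_bound_ge0// ltW.
have h1 := lipschitz_comp F0 hA (@twist_shear_lipschitz R (100 * r ^+ 2) r^-1 r)
  (fun p pB => let: And4 _ _ _ h := open_ball_coords pB in h).
have B0 : 0 <= lift_bound by rewrite addr_ge0 ?invr_ge0 ?mulr_ge0// ltW.
have G0 : 0 <= 4 + 2 * twist_bound (- r) (100 * r ^+ 2)^-1
    + twist_bound (- r) (100 * r ^+ 2)^-1 * lift_bound.
  by rewrite !addr_ge0 ?mulr_ge0 ?twist_bound_ge0.
have h2 := lipschitz_comp G0 h1 (squeeze_fold_lipschitz B0)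
  (fun p pB => let: And4 _ h _ h' := open_ball_coords pB in squeeze_lift_y1 h h').
by rewrite /squeeze_lipschitz_factor -!mulrA; rewrite -!mulrA in h2.
Qed.

(** On the k-th strip, [neck] takes the value 2 pi k + e with |e| <= 6 lam.
    After the lift the height x2 is 100 r^2 (2 pi k + e') with
    |e'| <= 13 lam; the fold then subtracts from x1 the plateau
    value 2 pi k r, leaving |x1| <= 20 lam r = 1 / 5.  The lift changes y1
    by at most 100 r^2 (1 - cos e) <= 36 / 100, because its slope vanishes to
    second order at the plateau. *)
Lemma squeeze_plateau_cylinder (p : R4 R) (k : int) : open_ball r p ->
  `|400 * r * x1 p - pi *+ 2 *~ k| <= 2 * atan (lam / c) -> cylinder (squeeze p).
Proof.
move=> /open_ball_coords[p1 p2 p3 p4].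
set P := pi *+ 2 *~ k; set t := 400 * r * x1 p - P => tM.
have lam01 : 0 < lam <= 1 by rewrite lam0.
have eM := neck_plateau c01 lam01 tM; set e := neck lam c t in eM.
pose q := squeeze_stretch p.
have qx : x1 q = r * (e + P).
  by rewrite /q [x1 _]/= -neck_period subrK.
pose q' := squeeze_lift q.
have mq : r^-1 * x1 q = e + P by rewrite qx mulKf// gt_eqF.
have q'x : x1 q' = x1 q by [].
have q'x2 : x2 q' = x2 p + 100 * r ^+ 2 * (e + P - sin e).
  rewrite (_ : x2 q' = x2 p + twist (100 * r ^+ 2) r^-1 (x1 q))//.
  by rewrite /twist mq /P sin_periodz.
have q'y : y1 q' = y1 q - 100 * r * (1 - cos e) * y2 p.
  rewrite (_ : y1 q' = y1 q - twist_slope (100 * r ^+ 2) r^-1 (x1 q) * y2 p)//.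
  rewrite /twist_slope mq /P cos_periodz.
  by rewrite (_ : 100 * r ^+ 2 / r = 100 * r)//; field; rewrite gt_eqF.
have p100 : 100 * r ^+ 2 != 0 by rewrite gt_eqF// mulr_gt0// exprn_gt0.
pose e' := (100 * r ^+ 2)^-1 * x2 p + (e - sin e).
have mq' : (100 * r ^+ 2)^-1 * x2 q' = e' + P.
  by rewrite q'x2 mulrDr mulKf// /e'; ring.
have sx : x1 (squeeze p) = r * (sin e - (100 * r ^+ 2)^-1 * x2 p + sin e').
  rewrite (_ : x1 _ = x1 q' + twist (- r) (100 * r ^+ 2)^-1 (x2 q'))//.
  by rewrite /twist mq' {2}/P sin_periodz q'x qx /e'; ring.
have sy : y1 (squeeze p) = y1 q' by [].
have x2M : `|(100 * r ^+ 2)^-1 * x2 p| <= lam.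
  have rr : 0 < 100 * r ^+ 2 by rewrite mulr_gt0// exprn_gt0.
  rewrite normrM gtr0_norm ?invr_gt0// mulrC ler_pdivrMr// (le_trans p3)//.
  have -> : lam * (100 * r ^+ 2) = r * (100 * r * lam) by ring.
  by rewrite lamr mulr1.
have seM := le_trans (norm_sin_le e) eM.
have se'M : `|sin e'| <= 13 * lam.
  rewrite (le_trans (norm_sin_le e'))// /e' (le_trans (ler_normD _ _))//.
  have := ler_normB e (sin e).
  by lra.
have sxM : `|x1 (squeeze p)| <= 5^-1.
  rewrite sx normrM (gtr0_norm r0).
  have h : `|sin e - (100 * r ^+ 2)^-1 * x2 p + sin e'| <= 20 * lam.
    rewrite (le_trans (ler_normD _ _))//.
    have := ler_normB (sin e) ((100 * r ^+ 2)^-1 * x2 p).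
    by lra.
  apply: le_trans (ler_wpM2l (ltW r0) h) _.
  by move: lamr; rewrite -mulrA; lra.
have syM : `|y1 (squeeze p)| <= 61 / 100.
  rewrite sy q'y (le_trans (ler_normB _ _))//.
  have yq : `|y1 q| <= 4^-1 by exact: squeeze_stretch_y1.
  have cM : 0 <= 1 - cos e <= 36 * lam ^+ 2.
    have := onemcos_le e; have := cos_le1 e; have := normr_ge0 e.
    by rewrite -[e ^+ 2]real_normK ?num_real// !expr2 => h1 h2 h3; apply/andP; split; nra.
  suff : `|100 * r * (1 - cos e) * y2 p| <= 36 / 100 by lra.
  have /andP[cM1 cM2] := cM.
  have hr : 0 <= 100 * r by rewrite mulr_ge0// ltW.
  rewrite normrM ger0_norm; last exact: mulr_ge0.
  have h : 100 * r * (1 - cos e) * `|y2 p| <= 100 * r * (36 * lam ^+ 2) * r.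
    by apply: ler_pM => //; [exact: mulr_ge0|exact: ler_wpM2l].
  apply: le_trans h _.
  have -> : 100 * r * (36 * lam ^+ 2) * r = 36 / 100 * (100 * r * lam) ^+ 2 by field.
  by rewrite lamr expr1n mulr1.
rewrite /cylinder /=.
have n1 := normr_ge0 (x1 (squeeze p)); have n2 := normr_ge0 (y1 (squeeze p)).
rewrite -[x1 (squeeze p) ^+ 2]real_normK ?num_real//.
rewrite -[y1 (squeeze p) ^+ 2]real_normK ?num_real//.
by move: n1 n2 sxM syM; move: `|x1 _| `|y1 _| => a b; rewrite !expr2; nra.
Qed.

(** The left end of the i-th neck on the x1-axis, in a list of 2N consecutive
    ones that is centred at the origin. *)
Definition neck_corner (N i : nat) : R :=
  (pi + pi *+ 2 *~ (i%:Z - N%:Z)) / (400 * r) - c / 2.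

(** Only necks that meet the ball matter.  Their number is bounded in terms
    of r, and each has width c. *)
Lemma squeeze_outside_cylinder (N : nat) : 151 * r ^+ 2 <= N%:R ->
  outside_cylinder r squeeze `<=` \bigcup_(i < N + N) slab r (neck_corner N i) c.
Proof.
move=> rN p [pB pC]; have [p1 p2 p3 p4] := open_ball_coords pB.
have [k [good|bad]] := neck_angle_cover (400 * r * x1 p) c0 lam0.
  by case: pC; exact: squeeze_plateau_cylinder good.
have p0 := pi_ge2 R; have c1 : c <= 1 by case/andP: c01 => _ /ltW.
have cl : c / lam = 100 * r * c.
  by apply: canLR (mulfK (lt0r_neq0 lam0)) _; rewrite mulrAC lamr mul1r.
set P := pi + pi *+ 2 *~ k in bad.
have PE : P = (1 + 2 * k%:~R) * pi by rewrite /P -[pi *+ 2 *~ k]mulrzl mulr2n; ring.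
rewrite cl in bad.
have r2r : r <= r ^+ 2 by rewrite expr2 ler_peMr// ltW.
(* With |pi + 2 pi k| <= 600 r^2 and pi >= 2 one gets |k| <= 150 r^2 + 1. *)
have PM : `|P| <= 600 * r ^+ 2.
  have -> : P = 400 * r * x1 p - (400 * r * x1 p - P) by ring.
  rewrite (le_trans (ler_normB _ _))//.
  have h1 : `|400 * r * x1 p| <= 400 * r ^+ 2.
    by rewrite normrM (gtr0_norm r400) expr2 mulrA ler_wpM2l// ltW.
  have h2 : r * c <= r by rewrite ler_piMr// ltW.
  move: bad h1 h2 r2r; rewrite -!mulrA; lra.
have kM : `|k%:~R| <= 150 * r ^+ 2 + 1 :> R.
  rewrite PE normrM (ger0_norm (_ : 0 <= pi)) ?pi_ge0// in PM.
  have n0 := normr_ge0 (1 + 2 * k%:~R : R).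
  have h : `|1 + 2 * k%:~R : R| <= 300 * r ^+ 2 by nra.
  by move: h; rewrite !ler_norml => /andP[h1 h2]; apply/andP; split; lra.
have r21 : 1 < r ^+ 2 by rewrite -[ltLHS](expr1n _ 2) ltr_pXn2r ?nnegrE ?ltW.
have : `|k%:~R| < N%:R :> R by apply: le_lt_trans kM _; lra.
rewrite ltr_norml -[N%:R]/(N%:Z%:~R) -mulrNz !ltr_int => /andP[k1 k2].
have [i ik] : exists i : nat, i%:Z = k + N%:Z.
  by exists (absz (k + N%:Z)); rewrite gez0_abs// -lerBlDr sub0r ltW.
exists i => /=; first by rewrite -ltz_nat ik PoszD ltrD2r.
have kE : i%:Z - N%:Z = k by rewrite ik addrK.
rewrite /slab /neck_corner kE -/P.
have xP : `|x1 p - P / (400 * r)| <= c / 2.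
  rewrite -(ler_pM2l r400) -{1}(gtr0_norm r400) -normrM mulrBr.
  rewrite [400 * r * (P / _)]mulrC divfK ?gt_eqF//.
  by apply: le_trans bad _; rewrite le_eqVlt; apply/orP; left; apply/eqP; field.
move: p2 p3 p4 xP; rewrite !ler_norml => /andP[? ?] /andP[? ?] /andP[? ?] /andP[? ?].
by do !split; rewrite /= in_itv /=; apply/andP; split => //; rewrite -/(x1 p); lra.
Qed.

End squeeze.

Lemma squeeze_lipschitz_factor_gt0 (R : realType) (r : R) : 1 < r ->
  0 < squeeze_lipschitz_factor r.
Proof.
move=> r1; have r0 : 0 < r by exact: lt_trans r1.
have pos (b B : R) : 0 <= b -> 0 <= B -> 0 < 4 + 2 * b + b * B.
  by move=> b0 B0; have := mulr_ge0 b0 B0; lra.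
apply: mulr_gt0; last apply: mulr_gt0.
- apply: pos; first exact: twist_bound_ge0.
  by rewrite addr_ge0 ?invr_ge0 ?mulr_ge0// ltW.
- by apply: pos; [exact: twist_bound_ge0|exact: ltW].
- apply: mulr_gt0; first by rewrite addr_gt0.
  by apply: mulr_gt0; [rewrite ltr0n|exact: exprn_gt0].
Qed.

Theorem theorem1p7 (R : realType) (r : R) (hr : 1 < r) :
  exists C : R, 0 < C /\
    forall L : R, 1 < L ->
      exists Phi : R4 R -> R4 R,
        [/\ symplectic_embedding (open_ball r) Phi,
            lipschitz_at_most L (open_ball r) Phi
          & (Vol4 (outside_cylinder r Phi) <= (C / L)%:E)%E].
Proof.
have r0 : 0 < r by exact: lt_trans hr.
set K := squeeze_lipschitz_factor r.
have K0 : 0 < K by exact: squeeze_lipschitz_factor_gt0.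
set N := Num.bound (151 * r ^+ 2).
have rN : 151 * r ^+ 2 <= N%:R.
  by apply/ltW/archi_boundP; rewrite mulr_ge0// exprn_ge0// ltW.
have r23 : 0 < (2 * r) ^+ 3 by rewrite exprn_gt0// mulr_gt0.
(* C1 / L bounds the volume of the necks, and C2 / K is that of a cube of side
   2 r, which contains the ball. *)
set C1 := (N + N)%:R * K * (2 * r) ^+ 3.
set C2 := K * (2 * r) * (2 * r) ^+ 3.
have C1_ge0 : 0 <= C1 := mulr_ge0 (mulr_ge0 (ler0n _ _) (ltW K0)) (ltW r23).
have r2 : 0 < 2 * r by exact: mulr_gt0.
have C2_gt0 : 0 < C2 := mulr_gt0 (mulr_gt0 K0 r2) r23.
exists (C1 + C2); split=> [|L L1]; first by rewrite ltr_wpDl.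
have L0 : 0 < L by exact: lt_trans L1.
have [KL|LK] := ltP K L; last first.
  exists (fun p => p); have eid := @identity_symplectomorphism R.
  split; first exact: elementary_symplectomorphism_embedding.
    by move=> p q _ _; rewrite ler_peMl ?sqrtr_ge0// ltW.
  case: (eid) => eid' _ _.
  apply: le_trans (Vol4_le_slabs (n := 1) (r := r) (l := 2 * r)
    (a := fun=> - r) _ _ _ _) _.
  - exact: ltW.
  - exact: ltW.
  - exact: measurable_outside_cylinder.
  - move=> p [/open_ball_coords[p1 p2 p3 p4] _]; exists 0%N => //.
    move: p1 p2 p3 p4; rewrite !ler_norml => /andP[? ?] /andP[? ?] /andP[? ?] /andP[? ?].
    by do !split; rewrite /= in_itv /=; apply/andP; split => //; rewrite -/(x1 p); lra.
  - rewrite lee_fin mul1r ler_pdivlMr//.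
    apply: (@le_trans _ _ C2); last by rewrite lerDr.
    have -> : 2 * r * (2 * r) ^+ 3 * L = L * (2 * r) * (2 * r) ^+ 3 by ring.
    rewrite /C2; apply: ler_wpM2r (ltW r23) _ _ _.
    exact: ler_wpM2r (ltW r2) _ _ LK.
pose c := K / L.
have c01 : 0 < c < 1 by rewrite divr_gt0//= ltr_pdivrMr// mul1r.
have lamr : 100 * r * (100 * r)^-1 = 1 by rewrite mulfV// gt_eqF// mulr_gt0.
exists (squeeze r c (100 * r)^-1).
have sq := squeeze_symplectomorphism hr c01 lamr.
split; first exact: elementary_symplectomorphism_embedding.
  have := squeeze_lipschitz hr c01 lamr.
  by rewrite -/K /c invf_div mulrCA divff ?gt_eqF// mulr1.
case: sq => sq _ _.
apply: le_trans (Vol4_le_slabs _ _ _ (squeeze_outside_cylinder hr c01 lamr rN)) _.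
- exact: ltW.
- by case/andP: c01 => /ltW.
- exact: measurable_outside_cylinder.
have -> : (N + N)%:R * c * (2 * r) ^+ 3 = C1 / L by rewrite /C1 /c; ring.
rewrite lee_fin.
by rewrite ler_wpM2r ?invr_ge0 ?(ltW L0)// lerDl ltW.
Qed.
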